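(* Let $\mathscr{T}$ be a triangulated category, let $\mathscr{B}$ be a small full subcategory of $\mathscr{T}$ closed under the translation functor $\Sigma$, and let $\mathscr{C}$ be the thick full subcategory of $\mathscr{T}$ generated by $\mathscr{B}$. If the component of the counit $$\varepsilon\colon \mathbb{P}\mathbb{F}X=\mathbb{P}\mathbb{U}\mathbb{Y}X\to \mathbb{Y}X$$ is an isomorphism in $\mathscr{P}\mathscr{C}$ for all $X\in\mathscr{C}$, then the Freyd conjecture holds for $(\mathscr{C},\mathscr{B})$.
   Context: Write $[X,Y]$ for the abelian group of maps $X\to Y$ in $\mathscr{T}$; also $\mathscr{B}(X,Y)=[X,Y]$ for $X,Y\in\mathscr{B}$ and $\mathscr{C}(X,Y)=[X,Y]$ for $X,Y\in\mathscr{C}$. The thick full subcategory $\mathscr{C}$ generated by $\mathscr{B}$ is the smallest full subcategory of $\mathscr{T}$ that contains $\mathscr{B}$, is closed under retracts, and has the property that if two terms of an exact triangle are in $\mathscr{C}$ then so is the third. $\mathscr{P}\mathscr{B}$ (resp. $\mathscr{P}\mathscr{C}$) is the category of additive functors $\mathscr{B}^{op}\to \mathrm{Ab}$ (resp. $\mathscr{C}^{op}\to\mathrm{Ab}$) and additive natural transformations. The Freyd functor $\mathbb{F}\colon\mathscr{T}\to\mathscr{P}\mathscr{B}$ sends $X$ to $\mathbb{F}X(-)=[-,X]$ and $f\colon X\to Y$ to $f_*=[-,f]$. The functor $\mathbb{Y}\colon\mathscr{T}\to\mathscr{P}\mathscr{C}$ is defined in the same way, $\mathbb{Y}X(-)=[-,X]$;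 restricted to $\mathscr{C}$ it is the Yoneda embedding. The Freyd conjecture is said to hold for the pair $(\mathscr{C},\mathscr{B})$ if the restriction $\mathbb{F}\colon\mathscr{C}\to\mathscr{P}\mathscr{B}$ is faithful, i.e. for every map $f$ in $\mathscr{C}$, $\mathbb{F}f=0$ if and only if $f=0$. $\mathbb{U}\colon\mathscr{P}\mathscr{C}\to\mathscr{P}\mathscr{B}$ is restriction of presheaves along the inclusion $\mathscr{B}\to\mathscr{C}$, so $\mathbb{F}=\mathbb{U}\mathbb{Y}$. $\mathbb{P}\colon\mathscr{P}\mathscr{B}\to\mathscr{P}\mathscr{C}$ is its left adjoint, given for $T\in\mathscr{P}\mathscr{B}$, $K\in\mathscr{C}$ by the categorical tensor product $\mathbb{P}T(K)=T\otimes_{\mathscr{B}}\mathscr{C}(K,-)$, that is, the coequalizer in $\mathrm{Ab}$ of the two maps $\bigoplus_{I,J\in\mathscr{B}}T(J)\otimes\mathscr{B}(I,J)\otimes\mathscr{C}(K,I)\rightrightarrows\bigoplus_{J\in\mathscr{B}}T(J)\otimes\mathscr{C}(K,J)$ given by the action of $\mathscr{B}$ on $T$ and by composition in $\mathscr{C}$. The natural transformation $\varepsilon\colon\mathbb{P}\mathbb{U}\to\mathrm{Id}$ is the counit of the adjunction $(\mathbb{P},\mathbb{U})$. *)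

(* Defs.v *)
From HB Require Import structures.
From mathcomp Require Import all_boot all_algebra.
From mathcomp Require Import generic_quotient ring_quotient freeg.
From mathcomp Require Import boolp.

Set Implicit Arguments.
Unset Strict Implicit.
Unset Printing Implicit Defensive.

Import GRing.Theory.
Local Open Scope ring_scope.
Local Open Scope quotient_scope.

Reserved Notation "g \oc f" (at level 40, left associativity).

(** * Constructions in the category of abelian groups *)

Lemma additive_ext (A B : zmodType) (f g : {additive A -> B}) :
  (forall x, f x = g x) -> f = g.
Proof.
case: f g => f [cf] [g [cg]] /= fg.
have efg : f = g by apply: funext.
case: _ / efg cg => cg.
suff -> : cf = cg by [].
by case: cf => pf; case: cg => pg; congr GRing.isNmodMorphism.phant_Build.
Qed.

Section MkAdditive.
Variables (A B : zmodType) (f : A -> B) (fD : {morph f : x y / x + y}).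

Let fB : {morph f : x y / x - y}.
Proof. by move=> x y; apply: (addIr (f y)); rewrite -fD !subrK. Qed.

Definition mk_additive : {additive A -> B} :=
  HB.pack f (GRing.isZmodMorphism.Build A B f fB).

Lemma mk_additiveE x : mk_additive x = f x. Proof. by []. Qed.
End MkAdditive.

Section QuotientGroup.
Variables (A : zmodType) (R : A -> Prop).

(* The subgroup generated by [R]. *)
Definition span : {pred A} := fun x => `[< forall N : A -> Prop,
  N 0 -> (forall y z, N y -> N z -> N (y - z)) ->
  (forall r, R r -> N r) -> N x >].

Lemma span_zmod_closed : zmod_closed span.
Proof.
split=> [|x y /asboolP Nx /asboolP Ny]; apply/asboolP => N N0 NB NR //.
by apply: (NB _ _ (Nx N N0 NB NR) (Ny N N0 NB NR)).
Qed.

HB.instance Definition _ := GRing.isZmodClosed.Build A span span_zmod_closed.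

Definition quot : zmodType := Quotient.quot span.

Lemma quot_pi_morph : {morph (fun x => \pi_quot x) : x y / x + y}.
Proof. by move=> x y; rewrite raddfD. Qed.

Definition quot_pi : {additive A -> quot} := mk_additive quot_pi_morph.

Lemma quot_pi_rel x y : R (x - y) -> quot_pi x = quot_pi y.
Proof.
move=> Rxy; apply/eqP; rewrite /= -Quotient.idealrBE.
by apply/asboolP => N _ _; apply.
Qed.

Lemma quot_ext (M : zmodType) (f g : {additive quot -> M}) :
  (forall x, f (quot_pi x) = g (quot_pi x)) -> f =1 g.
Proof. by move=> fg x; rewrite -[x]reprK; apply: fg. Qed.

Section Lift.
Variables (M : zmodType) (f : {additive A -> M}).
Hypothesis fR : forall r, R r -> f r = 0.

Lemma quot_liftP x : f (repr (quot_pi x)) = f x.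
Proof.
apply/eqP; rewrite -subr_eq0 -raddfB.
have /asboolP : repr (quot_pi x) - x \in span.
  by rewrite Quotient.idealrBE reprK.
move/(_ (fun z => f z = 0)) => /(_ (raddf0 f)) H; apply/eqP/H => //.
by move=> y z fy fz; rewrite raddfB fy fz subrr.
Qed.

Lemma quot_lift_morph : {morph (fun x : quot => f (repr x)) : x y / x + y}.
Proof.
move=> x y; have := quot_liftP (repr x + repr y).
have rK z : quot_pi (repr (z : quot)) = z by exact: reprK.
by rewrite raddfD !rK raddfD.
Qed.

Definition quot_lift : {additive quot -> M} := mk_additive quot_lift_morph.

Lemma quot_liftE x : quot_lift (quot_pi x) = f x.
Proof. exact: quot_liftP. Qed.
End Lift.
End QuotientGroup.

Section FreeGroup.
Variable X : Type.

(* [{classic X}] equips an arbitrary type with the choice structure that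
   [{freeg _ / int}] requires. *)
Definition free : zmodType := {freeg {classic X} / int}.
Definition gen (x : X) : free := << (x : {classic X}) >>.

Lemma free_ext (M : zmodType) (f g : {additive free -> M}) :
  (forall x, f (gen x) = g (gen x)) -> f =1 g.
Proof.
move=> fg D; rewrite -(freeg_sumE D) !raddf_sum.
apply: eq_bigr => x _; rewrite -[coeff x D]mulr1 -[coeff x D]intz.
by rewrite mulrzl -freegU_mulz !raddfMz; congr (_ *~ _); apply: fg.
Qed.

Section Lift.
Variables (M : zmodType) (f : X -> M).
Let fM : {classic X} -> zmodule M := f.

Lemma free_lift_morph : {morph (fglift fM : free -> M) : x y / x + y}.
Proof.
move=> x y; have fB := @lift_is_additive _ _ _ fM.
have f0 : fglift fM 0 = 0 by rewrite -(subrr 0) fB subrr.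
by rewrite -{1}[y]opprK -[- y]sub0r fB fB f0 sub0r opprK.
Qed.

Definition free_lift : {additive free -> M} := mk_additive free_lift_morph.

Lemma free_liftE x : free_lift (gen x) = f x.
Proof. by rewrite /= liftU scale1r. Qed.
End Lift.
End FreeGroup.

Section Tensor.
Variables A B : zmodType.

Inductive tensor_rel : free (A * B) -> Prop :=
| tensor_relDl a a' b :
    tensor_rel (gen (a + a', b) - (gen (a, b) + gen (a', b)))
| tensor_relDr a b b' :
    tensor_rel (gen (a, b + b') - (gen (a, b) + gen (a, b'))).

Definition tensor : zmodType := quot tensor_rel.
Definition tens (a : A) (b : B) : tensor := quot_pi tensor_rel (gen (a, b)).

Lemma tensDl a a' b : tens (a + a') b = tens a b + tens a' b.
Proof. by rewrite /tens -raddfD; apply/quot_pi_rel/tensor_relDl. Qed.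

Lemma tensDr a b b' : tens a (b + b') = tens a b + tens a b'.
Proof. by rewrite /tens -raddfD; apply/quot_pi_rel/tensor_relDr. Qed.

Lemma tensor_ext (M : zmodType) (f g : {additive tensor -> M}) :
  (forall a b, f (tens a b) = g (tens a b)) -> f =1 g.
Proof.
move=> fg; apply: quot_ext => x.
by apply: (free_ext (f := f \o quot_pi tensor_rel) (g := g \o quot_pi tensor_rel)) => -[a b]; apply: fg.
Qed.

Section Lift.
Variables (M : zmodType) (f : A -> B -> M).
Hypotheses (fDl : forall b, {morph f^~ b : a a' / a + a'})
           (fDr : forall a, {morph f a : b b' / b + b'}).

Lemma tensor_lift_subproof r :
  tensor_rel r -> free_lift (fun p : A * B => f p.1 p.2) r = 0.
Proof.
by case=> [a a' b|a b b']; rewrite raddfB raddfD !free_liftE /= (fDl, fDr) subrr.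
Qed.

Definition tensor_lift : {additive tensor -> M} := quot_lift tensor_lift_subproof.

Lemma tensor_liftE a b : tensor_lift (tens a b) = f a b.
Proof. by rewrite [LHS]quot_liftE free_liftE. Qed.
End Lift.
End Tensor.

Section TensorMap.
Variables (A A' B B' : zmodType).
Variables (f : {additive A -> A'}) (g : {additive B -> B'}).

Lemma tensor_map_Dl b : {morph (fun a => tens (f a) (g b)) : a a' / a + a'}.
Proof. by move=> a a'; rewrite raddfD tensDl. Qed.

Lemma tensor_map_Dr a : {morph (fun b => tens (f a) (g b)) : b b' / b + b'}.
Proof. by move=> b b'; rewrite raddfD tensDr. Qed.

Definition tensor_map : {additive tensor A B -> tensor A' B'} :=
  tensor_lift tensor_map_Dl tensor_map_Dr.

Lemma tensor_mapE a b : tensor_map (tens a b) = tens (f a) (g b).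
Proof. exact: tensor_liftE. Qed.
End TensorMap.

Section TensorAssoc.
Variables A B C : zmodType.

Lemma tensor_assoc_subproof_l (c : C) (a : A) :
  {morph (fun b : B => tens a (tens b c)) : b b' / b + b'}.
Proof. by move=> b b'; rewrite tensDl tensDr. Qed.

Lemma tensor_assoc_subproof_r (c : C) (b : B) :
  {morph (fun a : A => tens a (tens b c)) : a a' / a + a'}.
Proof. by move=> a a'; rewrite tensDl. Qed.

Definition tensor_assoc1 (c : C) : {additive tensor A B -> tensor A (tensor B C)} :=
  tensor_lift (tensor_assoc_subproof_r c) (tensor_assoc_subproof_l c).

Lemma tensor_assoc1E c a b : tensor_assoc1 c (tens a b) = tens a (tens b c).
Proof. exact: tensor_liftE. Qed.

Lemma tensor_assoc1D x :
  {morph (fun c => tensor_assoc1 c x) : c c' / c + c'}.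
Proof.
move=> c c'; apply: (tensor_ext (g := tensor_assoc1 c \+ tensor_assoc1 c')).
move=> a b; rewrite -[RHS]/(tensor_assoc1 c (tens a b) + tensor_assoc1 c' (tens a b)).
by rewrite !tensor_assoc1E !tensDr.
Qed.

Lemma tensor_assoc1Dl c : {morph tensor_assoc1 c : x x' / x + x'}.
Proof. exact: raddfD. Qed.

Definition tensor_assoc : {additive tensor (tensor A B) C -> tensor A (tensor B C)} :=
  tensor_lift (f := fun x c => tensor_assoc1 c x) tensor_assoc1Dl tensor_assoc1D.

Lemma tensor_assocE a b c :
  tensor_assoc (tens (tens a b) c) = tens a (tens b c).
Proof. by rewrite [LHS]tensor_liftE tensor_assoc1E. Qed.

Lemma tensor_ext3 (M : zmodType) (f g : {additive tensor (tensor A B) C -> M}) :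
  (forall a b c, f (tens (tens a b) c) = g (tens (tens a b) c)) -> f =1 g.
Proof.
move=> fg; apply: tensor_ext => x c.
have D (h : {additive tensor (tensor A B) C -> M}) :
  {morph (fun z => h (tens z c)) : z z' / z + z'}.
  by move=> z z'; rewrite tensDl raddfD.
apply: (tensor_ext (f := mk_additive (D f)) (g := mk_additive (D g))) => a b.
exact: fg.
Qed.
End TensorAssoc.

Section DirectSum.
Variables (I : Type) (A : I -> zmodType).

Local Notation sgen i a := (gen (existT (fun j => A j : Type) i a)).

(* The direct sum is presented by one generator for each element of each summand,
   subject to additivity in each summand; [dsum_liftE] and [dsum_ext] are its
   universal property. *)
Inductive dsum_rel : free {i : I & A i} -> Prop :=
| dsum_relD i a a' :
    dsum_rel (sgen i (a + a') - (sgen i a + sgen i a')).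

Definition dsum : zmodType := quot dsum_rel.

Lemma dsum_in_morph i :
  {morph (fun a : A i => quot_pi dsum_rel (sgen i a)) : a a' / a + a'}.
Proof. by move=> a a'; rewrite -raddfD; apply/quot_pi_rel/dsum_relD. Qed.

Definition dsum_in i : {additive A i -> dsum} := mk_additive (@dsum_in_morph i).

Lemma dsum_ext (M : zmodType) (f g : {additive dsum -> M}) :
  (forall i a, f (dsum_in i a) = g (dsum_in i a)) -> f =1 g.
Proof.
move=> fg; apply: quot_ext => x.
by apply: (free_ext (f := f \o quot_pi dsum_rel) (g := g \o quot_pi dsum_rel)) => -[i a]; apply: fg.
Qed.

Section Lift.
Variables (M : zmodType) (f : forall i, {additive A i -> M}).

Lemma dsum_lift_subproof r :
  dsum_rel r -> free_lift (fun p : {i : I & A i} => f (tag p) (tagged p)) r = 0.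
Proof.
by case=> [i a a']; rewrite raddfB raddfD !free_liftE /= raddfD subrr.
Qed.

Definition dsum_lift : {additive dsum -> M} := quot_lift dsum_lift_subproof.

Lemma dsum_liftE i a : dsum_lift (dsum_in i a) = f i a.
Proof. by rewrite [LHS]quot_liftE free_liftE. Qed.
End Lift.
End DirectSum.

Section Coequalizer.
Variables (A B : zmodType) (f g : {additive A -> B}).

Definition coeq : zmodType := quot (fun y => exists x, y = f x - g x).
Definition coeq_pi : {additive B -> coeq} := quot_pi _.

Lemma coeq_piE x : coeq_pi (f x) = coeq_pi (g x).
Proof. by apply: quot_pi_rel; exists x. Qed.

Lemma coeq_ext (M : zmodType) (h k : {additive coeq -> M}) :
  (forall y, h (coeq_pi y) = k (coeq_pi y)) -> h =1 k.
Proof. exact: quot_ext. Qed.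

Section Lift.
Variables (M : zmodType) (h : {additive B -> M}).
Hypothesis hfg : forall x, h (f x) = h (g x).

Lemma coeq_lift_subproof r : (exists x, r = f x - g x) -> h r = 0.
Proof. by case=> x ->; rewrite raddfB hfg subrr. Qed.

Definition coeq_lift : {additive coeq -> M} := quot_lift coeq_lift_subproof.

Lemma coeq_liftE y : coeq_lift (coeq_pi y) = h y.
Proof. exact: quot_liftE. Qed.
End Lift.
End Coequalizer.

(** * Categories *)

Record category := Category {
  ob :> Type;
  hom : ob -> ob -> Type;
  idm : forall X, hom X X;
  comp : forall X Y Z, hom Y Z -> hom X Y -> hom X Z;
  compA : forall W X Y Z (h : hom Y Z) (g : hom X Y) (f : hom W X),
    comp h (comp g f) = comp (comp h g) f;
  comp1m : forall X Y (f : hom X Y), comp (idm Y) f = f;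
  compm1 : forall X Y (f : hom X Y), comp f (idm X) = f }.

Arguments hom {c} X Y.
Arguments idm {c} X.
Arguments comp {c X Y Z} g f : rename.
Notation "g \oc f" := (comp g f).

Definition eq_hom (C : category) (X Y : C) (e : X = Y) : hom X Y :=
  ecast Z (hom X Z) e (idm X).

Lemma eq_homV (C : category) (X Y : C) (e : X = Y) :
  eq_hom e \oc eq_hom (esym e) = idm Y.
Proof. by case: _ / e; apply: comp1m. Qed.

Definition is_iso (C : category) (X Y : C) (f : hom X Y) :=
  exists g : hom Y X, g \oc f = idm X /\ f \oc g = idm Y.

Record functor (C D : category) := Functor {
  fob :> C -> D;
  fmor : forall X Y, hom X Y -> hom (fob X) (fob Y);
  fmor1 : forall X, fmor (idm X) = idm (fob X);
  fmorM : forall X Y Z (g : hom Y Z) (f : hom X Y),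
    fmor (g \oc f) = fmor g \oc fmor f }.

Arguments fmor {C D} F {X Y} f : rename.

Definition faithful (C D : category) (F : functor C D) :=
  forall (X Y : C) (f g : hom X Y), fmor F f = fmor F g -> f = g.

Definition id_functor (C : category) : functor C C :=
  @Functor C C id (fun _ _ f => f) (fun=> erefl) (fun _ _ _ _ _ => erefl).

Section FunctorComp.
Variables (C D E : category) (G : functor D E) (F : functor C D).

Lemma functor_comp1 X : fmor G (fmor F (idm X)) = idm (G (F X)).
Proof. by rewrite !fmor1. Qed.

Lemma functor_compM X Y Z (g : hom Y Z) (f : hom X Y) :
  fmor G (fmor F (g \oc f)) = fmor G (fmor F g) \oc fmor G (fmor F f).
Proof. by rewrite !fmorM. Qed.

Definition functor_comp : functor C E :=
  @Functor C E (fun X => G (F X)) (fun _ _ f => fmor G (fmor F f))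
    functor_comp1 functor_compM.
End FunctorComp.

Definition nat_iso (C D : category) (F G : functor C D) :=
  exists a : forall X, hom (F X) (G X),
    (forall X Y (f : hom X Y), a Y \oc fmor F f = fmor G f \oc a X) /\
    (forall X, is_iso (a X)).

Definition is_equivalence (C D : category) (F : functor C D) :=
  exists G : functor D C, nat_iso (id_functor C) (functor_comp G F) /\
    nat_iso (functor_comp F G) (id_functor D).

Record adjunction (C D : category) (L : functor C D) (R : functor D C) :=
  Adjunction {
  adj : forall X Y, hom (L X) Y -> hom X (R Y);
  adjV : forall X Y, hom X (R Y) -> hom (L X) Y;
  adjK : forall X Y, cancel (@adj X Y) (@adjV X Y);
  adjVK : forall X Y, cancel (@adjV X Y) (@adj X Y);
  adj_natl : forall X X' Y (f : hom X' X) (h : hom (L X) Y),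
    adj (h \oc fmor L f) = adj h \oc f;
  adj_natr : forall X Y Y' (g : hom Y Y') (h : hom (L X) Y),
    adj (g \oc h) = fmor R g \oc adj h }.

Definition counit (C D : category) (L : functor C D) (R : functor D C)
    (a : adjunction L R) (Y : D) : hom (L (R Y)) Y :=
  adjV a (idm (R Y)).

(** * Preadditive categories *)

(* The hom groups of a preadditive category live in the universe of [zmodType].
   The hom types of [category] are kept separate, because natural transformations
   between presheaves on a large category live in a larger universe. *)
Record preadditive := Preadditive {
  pob : Type;
  phom : pob -> pob -> zmodType;
  pidm : forall X, phom X X;
  pcomp : forall X Y Z, phom Y Z -> phom X Y -> phom X Z;
  pcompA : forall W X Y Z (h : phom Y Z) (g : phom X Y) (f : phom W X),
    pcomp h (pcomp g f) = pcomp (pcomp h g) f;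
  pcomp1m : forall X Y (f : phom X Y), pcomp (pidm Y) f = f;
  pcompm1 : forall X Y (f : phom X Y), pcomp f (pidm X) = f;
  pcompDl : forall X Y Z (g g' : phom Y Z) (f : phom X Y),
    pcomp (g + g') f = pcomp g f + pcomp g' f;
  pcompDr : forall X Y Z (g : phom Y Z) (f f' : phom X Y),
    pcomp g (f + f') = pcomp g f + pcomp g f' }.

Coercion cat_of (A : preadditive) : category :=
  @Category (pob A) (fun X Y => phom X Y) (@pidm A) (@pcomp A)
    (@pcompA A) (@pcomp1m A) (@pcompm1 A).

Lemma compDl (A : preadditive) (X Y Z : A) (g g' : hom Y Z) (f : hom X Y) :
  (g + g' : hom Y Z) \oc f = g \oc f + g' \oc f.
Proof. exact: pcompDl. Qed.

Lemma compDr (A : preadditive) (X Y Z : A) (g : hom Y Z) (f f' : hom X Y) :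
  g \oc (f + f' : hom X Y) = g \oc f + g \oc f'.
Proof. exact: pcompDr. Qed.

Lemma comp0m (A : preadditive) (X Y Z : A) (f : hom X Y) :
  (0 : hom Y Z) \oc f = 0.
Proof. by have := compDl (0 : hom Y Z) 0 f; rewrite addr0 -[LHS]addr0 => /addrI. Qed.

Lemma compm0 (A : preadditive) (X Y Z : A) (g : hom Y Z) :
  g \oc (0 : hom X Y) = 0.
Proof. by have := compDr g (0 : hom X Y) 0; rewrite addr0 -[LHS]addr0 => /addrI. Qed.

Record additive_functor (A B : preadditive) := AdditiveFunctor {
  afunctor :> functor A B;
  fmorD : forall (X Y : A) (f g : hom X Y),
    fmor afunctor (f + g) = fmor afunctor f + fmor afunctor g }.

Section Full.
Variables (A : preadditive) (P : A -> Prop).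

(* The full subcategory on the objects satisfying [P]. *)
Definition full : preadditive :=
  @Preadditive {X : A | P X} (fun X Y => @phom A (sval X) (sval Y))
    (fun X => @pidm A (sval X))
    (fun X Y Z => @pcomp A (sval X) (sval Y) (sval Z))
    (fun W X Y Z => @pcompA A (sval W) (sval X) (sval Y) (sval Z))
    (fun X Y => @pcomp1m A (sval X) (sval Y))
    (fun X Y => @pcompm1 A (sval X) (sval Y))
    (fun X Y Z => @pcompDl A (sval X) (sval Y) (sval Z))
    (fun X Y Z => @pcompDr A (sval X) (sval Y) (sval Z)).

Definition full_incl : additive_functor full A :=
  @AdditiveFunctor full A
    (@Functor full A sval (fun _ _ f => f) (fun=> erefl) (fun _ _ _ _ _ => erefl))
    (fun _ _ _ _ => erefl).
End Full.

Definition full_sub (A : preadditive) (P Q : A -> Prop)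
    (PQ : forall X, P X -> Q X) : additive_functor (full P) (full Q) :=
  @AdditiveFunctor (full P) (full Q)
    (@Functor (full P) (full Q) (fun X => exist Q (sval X) (PQ _ (svalP X)))
      (fun _ _ f => f) (fun=> erefl) (fun _ _ _ _ _ => erefl))
    (fun _ _ _ _ => erefl).

(** * Triangulated categories *)

Definition is_zero (A : preadditive) (Z : A) :=
  (forall (X : A) (f : hom X Z), f = 0) /\ (forall (X : A) (f : hom Z X), f = 0).

Definition is_biproduct (A : preadditive) (X Y S : A)
    (i : hom X S) (j : hom Y S) (p : hom S X) (q : hom S Y) :=
  [/\ p \oc i = idm X, q \oc j = idm Y, p \oc j = 0, q \oc i = 0 &
      i \oc p + j \oc q = idm S].

(* Verdier's axioms TR1--TR4 ([exact_tri_oct] is the octahedral axiom) on an additive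
   category whose translation [Sigma] is an additive self-equivalence. *)
Record triangulated := Triangulated {
  tri_cat :> preadditive;
  has_zero : exists Z : tri_cat, is_zero Z;
  has_biproducts : forall X Y : tri_cat, exists (S : tri_cat)
    (i : hom X S) (j : hom Y S) (p : hom S X) (q : hom S Y),
    is_biproduct i j p q;
  Sigma : additive_functor tri_cat tri_cat;
  Sigma_equiv : is_equivalence Sigma;
  exact_tri : forall X Y Z : tri_cat,
    hom X Y -> hom Y Z -> hom Z (Sigma X) -> Prop;
  exact_tri_iso : forall (X Y Z X' Y' Z' : tri_cat)
    (f : hom X Y) (g : hom Y Z) (h : hom Z (Sigma X))
    (f' : hom X' Y') (g' : hom Y' Z') (h' : hom Z' (Sigma X'))
    (a : hom X X') (b : hom Y Y') (c : hom Z Z'),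
    is_iso a -> is_iso b -> is_iso c ->
    b \oc f = f' \oc a -> c \oc g = g' \oc b -> fmor Sigma a \oc h = h' \oc c ->
    exact_tri f g h -> exact_tri f' g' h';
  exact_tri_id : forall X Z : tri_cat, is_zero Z ->
    exact_tri (idm X) (0 : hom X Z) (0 : hom Z (Sigma X));
  exact_tri_cone : forall (X Y : tri_cat) (f : hom X Y),
    exists (Z : tri_cat) (g : hom Y Z) (h : hom Z (Sigma X)), exact_tri f g h;
  exact_tri_rot : forall (X Y Z : tri_cat)
    (f : hom X Y) (g : hom Y Z) (h : hom Z (Sigma X)),
    exact_tri f g h <-> exact_tri g h (- fmor Sigma f);
  exact_tri_map : forall (X Y Z X' Y' Z' : tri_cat)
    (f : hom X Y) (g : hom Y Z) (h : hom Z (Sigma X))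
    (f' : hom X' Y') (g' : hom Y' Z') (h' : hom Z' (Sigma X'))
    (a : hom X X') (b : hom Y Y'),
    exact_tri f g h -> exact_tri f' g' h' -> b \oc f = f' \oc a ->
    exists c : hom Z Z', c \oc g = g' \oc b /\ fmor Sigma a \oc h = h' \oc c;
  exact_tri_oct : forall (X Y Z Cf Cg Cgf : tri_cat)
    (f : hom X Y) (g : hom Y Z)
    (u : hom Y Cf) (v : hom Cf (Sigma X))
    (w : hom Z Cg) (x : hom Cg (Sigma Y))
    (p : hom Z Cgf) (q : hom Cgf (Sigma X)),
    exact_tri f u v -> exact_tri g w x -> exact_tri (g \oc f) p q ->
    exists (a : hom Cf Cgf) (b : hom Cgf Cg),
      exact_tri a b (fmor Sigma u \oc x) /\
      [/\ a \oc u = p \oc g, q \oc a = v, b \oc p = w &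
          x \oc b = fmor Sigma f \oc q] }.

Definition is_retract (C : category) (X Y : C) :=
  exists (i : hom X Y) (r : hom Y X), r \oc i = idm X.

Record thick_class (T : triangulated) (P : T -> Prop) : Prop := ThickClass {
  thick_retract : forall X Y : T, is_retract X Y -> P Y -> P X;
  thick_tri : forall (X Y Z : T)
    (f : hom X Y) (g : hom Y Z) (h : hom Z (Sigma T X)), exact_tri f g h ->
    [/\ P X -> P Y -> P Z, P Y -> P Z -> P X & P X -> P Z -> P Y] }.

(* The smallest class containing [B] that is closed under retracts and has the
   two-out-of-three property; see [sub_thick] and [thick_thick_class]. *)
Definition thick (T : triangulated) (B : T -> Prop) (X : T) : Prop :=
  forall P : T -> Prop, thick_class P -> (forall Y, B Y -> P Y) -> P X.

Lemma sub_thick (T : triangulated) (B : T -> Prop) (X : T) : B X -> thick B X.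
Proof. by move=> BX P _; apply. Qed.

Lemma thick_thick_class (T : triangulated) (B : T -> Prop) : thick_class (thick B).
Proof.
split=> [X Y rXY BY P tP BP | X Y Z f g h fgh].
  exact: (thick_retract tP rXY (BY P tP BP)).
split=> H1 H2 P tP BP; have [k1 k2 k3] := thick_tri tP fgh.
- exact: k1 (H1 P tP BP) (H2 P tP BP).
- exact: k2 (H1 P tP BP) (H2 P tP BP).
- exact: k3 (H1 P tP BP) (H2 P tP BP).
Qed.

(** * Presheaves *)

(* Additive functors from the opposite of [A] to abelian groups. *)
Record presheaf (A : preadditive) := Presheaf {
  psh_ob :> A -> zmodType;
  psh_mor : forall X Y : A, hom X Y -> {additive psh_ob Y -> psh_ob X};
  psh_mor1 : forall X x, psh_mor (idm X) x = x;
  psh_morM : forall (X Y Z : A) (g : hom Y Z) (f : hom X Y) x,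
    psh_mor (g \oc f) x = psh_mor f (psh_mor g x);
  psh_morD : forall (X Y : A) (f g : hom X Y) x,
    psh_mor (f + g) x = psh_mor f x + psh_mor g x }.

Arguments psh_mor {A} F {X Y} f : rename.

Record psh_hom (A : preadditive) (F G : presheaf A) := PshHom {
  psh_comp :> forall X, {additive F X -> G X};
  psh_nat : forall (X Y : A) (f : hom X Y) x,
    psh_comp X (psh_mor F f x) = psh_mor G f (psh_comp Y x) }.

Lemma psh_hom_ext (A : preadditive) (F G : presheaf A) (a b : psh_hom F G) :
  (forall X x, a X x = b X x) -> a = b.
Proof.
case: a b => a na [b nb] /= ab.
have eab : a = b by apply: functional_extensionality_dep => X; exact: additive_ext (ab X).
by case: _ / eab nb => nb; congr PshHom.
Qed.

Section PshCat.
Variable A : preadditive.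

Definition psh_idm (F : presheaf A) : psh_hom F F :=
  @PshHom A F F (fun X => idfun) (fun _ _ _ _ => erefl).

Section Comp.
Variables (F G H : presheaf A) (b : psh_hom G H) (a : psh_hom F G).

Lemma psh_hcomp_nat (X Y : A) (f : hom X Y) x :
  (b X \o a X) (psh_mor F f x) = psh_mor H f ((b Y \o a Y) x).
Proof. by rewrite /= !psh_nat. Qed.

Definition psh_hcomp : psh_hom F H :=
  @PshHom A F H (fun X => b X \o a X) psh_hcomp_nat.
End Comp.

Lemma psh_hcompA (F G H K : presheaf A)
    (c : psh_hom H K) (b : psh_hom G H) (a : psh_hom F G) :
  psh_hcomp c (psh_hcomp b a) = psh_hcomp (psh_hcomp c b) a.
Proof. exact: psh_hom_ext. Qed.

Lemma psh_hcomp1m (F G : presheaf A) (a : psh_hom F G) :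
  psh_hcomp (psh_idm G) a = a.
Proof. exact: psh_hom_ext. Qed.

Lemma psh_hcompm1 (F G : presheaf A) (a : psh_hom F G) :
  psh_hcomp a (psh_idm F) = a.
Proof. exact: psh_hom_ext. Qed.

Definition psh : category :=
  Category psh_hcompA psh_hcomp1m psh_hcompm1.
End PshCat.

Section Restriction.
Variables (A C : preadditive) (j : additive_functor A C).

Section Ob.
Variable G : presheaf C.

Lemma restr_mor1 (X : A) (x : G (j X)) : psh_mor G (fmor j (idm X)) x = x.
Proof. by rewrite fmor1 psh_mor1. Qed.

Lemma restr_morM (X Y Z : A) (g : hom Y Z) (f : hom X Y) x :
  psh_mor G (fmor j (g \oc f)) x = psh_mor G (fmor j f) (psh_mor G (fmor j g) x).
Proof. by rewrite fmorM psh_morM. Qed.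

Lemma restr_morD (X Y : A) (f g : hom X Y) x :
  psh_mor G (fmor j (f + g)) x =
  psh_mor G (fmor j f) x + psh_mor G (fmor j g) x.
Proof. by rewrite fmorD psh_morD. Qed.

Definition restr_ob : presheaf A :=
  @Presheaf A (fun X => G (j X)) (fun _ _ f => psh_mor G (fmor j f))
    restr_mor1 restr_morM restr_morD.
End Ob.

Definition restr_mor (G H : presheaf C) (a : psh_hom G H) :
    psh_hom (restr_ob G) (restr_ob H) :=
  @PshHom A (restr_ob G) (restr_ob H) (fun X => a (j X))
    (fun _ _ _ _ => psh_nat a _ _).

Lemma restr_mor_id (G : psh C) : restr_mor (idm G) = idm (restr_ob G : psh A).
Proof. exact: psh_hom_ext. Qed.

Lemma restr_mor_comp (G H K : psh C) (b : hom H K) (a : hom G H) :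
  restr_mor (b \oc a) = (restr_mor b : hom (restr_ob H : psh A) (restr_ob K)) \oc restr_mor a.
Proof. exact: psh_hom_ext. Qed.

Definition restr : functor (psh C) (psh A) :=
  @Functor (psh C) (psh A) restr_ob restr_mor restr_mor_id restr_mor_comp.
End Restriction.

(* [yoneda j X] is the presheaf [K |-> hom (j K) X]. *)
Section Yoneda.
Variables (A T : preadditive) (j : additive_functor A T).

Section Ob.
Variable X : T.

Lemma yoneda_act_D (K L : A) (f : hom K L) :
  {morph (fun x : hom (j L) X => x \oc fmor j f) : x y / x + y}.
Proof. by move=> x y; apply: compDl. Qed.

Definition yoneda_act (K L : A) (f : hom K L) :
    {additive phom (j L) X -> phom (j K) X} :=
  mk_additive (yoneda_act_D f).

Lemma yoneda_act1 (K : A) x : yoneda_act (idm K) x = x.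
Proof. by rewrite /= fmor1; exact: (@compm1 T (j K) X x). Qed.

Lemma yoneda_actM (K L M : A) (g : hom L M) (f : hom K L) x :
  yoneda_act (g \oc f) x = yoneda_act f (yoneda_act g x).
Proof. by rewrite /= fmorM; exact: (@compA T _ _ _ X x). Qed.

Lemma yoneda_actD (K L : A) (f g : hom K L) x :
  yoneda_act (f + g) x = yoneda_act f x + yoneda_act g x.
Proof. by rewrite /= fmorD; exact: (@compDr T _ _ X x). Qed.

Definition yoneda_ob : presheaf A :=
  Presheaf yoneda_act1 yoneda_actM yoneda_actD.
End Ob.

Section Mor.
Variables (X Y : T) (f : hom X Y).

Lemma yoneda_mor_D (K : A) :
  {morph (fun x : hom (j K) X => f \oc x) : x y / x + y}.
Proof. by move=> x y; apply: compDr. Qed.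

Definition yoneda_mor : psh_hom (yoneda_ob X) (yoneda_ob Y) :=
  @PshHom A (yoneda_ob X) (yoneda_ob Y) (fun K => mk_additive (@yoneda_mor_D K))
    (fun K L g x => @compA T _ _ X Y f x _).
End Mor.

Lemma yoneda_mor1 (X : T) : yoneda_mor (idm X) = idm (yoneda_ob X : psh A).
Proof. by apply: psh_hom_ext => K x; exact: (@comp1m T (j K) X x). Qed.

Lemma yoneda_morM (X Y Z : T) (g : hom Y Z) (f : hom X Y) :
  yoneda_mor (g \oc f) =
  (yoneda_mor g : hom (yoneda_ob Y : psh A) (yoneda_ob Z)) \oc yoneda_mor f.
Proof. by apply: psh_hom_ext => K x; symmetry; exact: (@compA T (j K) X Y Z g f x). Qed.

Definition yoneda : functor T (psh A) :=
  @Functor T (psh A) yoneda_ob yoneda_mor yoneda_mor1 yoneda_morM.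
End Yoneda.

(** * The left adjoint of restriction *)

(* A bijection with a type in a fixed universe. The direct sums below are indexed by
   [sm_index] and are abelian groups, so this universe is at most that of the hom
   groups, whereas the objects of a [preadditive] category may live in a larger one. *)
Record small (X : Type) := Small {
  sm_index : Type;
  sm_in : sm_index -> X;
  sm_of : X -> sm_index;
  sm_inK : cancel sm_in sm_of;
  sm_ofK : cancel sm_of sm_in }.

Arguments sm_in {X} s i : rename.
Arguments sm_of {X} s x : rename.

(* For [F] a presheaf on a small [A], [ext_val F K] is the tensor product of [F] and
   [hom K (j -)] over [A]: the coequalizer of
     [ext_mapl : t (x) b (x) g |-> (F b) t (x) g] and
     [ext_mapr : t (x) b (x) g |-> t (x) (j b \oc g)]
   for [t : F Y], [b : hom X Y] and [g : hom K (j X)]. *)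
Section Extension.
Variables (A C : preadditive) (j : additive_functor A C) (sA : small A).

Local Notation I := (sm_index sA).
Local Notation "# i" := (sm_in sA i : ob (cat_of A)) (at level 2, format "# i").

Section Ob.
Variable F : presheaf A.

Section Value.
Variable K : C.

Definition ext_src (p : I * I) : zmodType :=
  tensor (tensor (F #(p.2)) (phom #(p.1) #(p.2))) (phom K (j #(p.1))).

Definition ext_tgt (k : I) : zmodType := tensor (F #k) (phom K (j #k)).

Definition ext_act (X Y : A) : {additive tensor (F Y) (phom X Y) -> F X} :=
  tensor_lift (f := fun t (b : hom X Y) => psh_mor F b t)
    (fun b => raddfD (psh_mor F b)) (fun t b b' => psh_morD b b' t).

Lemma ext_comp_Dl (X Y : A) (g : hom K (j X)) :
  {morph (fun b : hom X Y => fmor j b \oc g) : b b' / b + b'}.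
Proof. by move=> b b'; rewrite fmorD; apply: compDl. Qed.

Lemma ext_comp_Dr (X Y : A) (b : hom X Y) :
  {morph (fun g : hom K (j X) => fmor j b \oc g) : g g' / g + g'}.
Proof. by move=> g g'; apply: compDr. Qed.

Definition ext_comp (X Y : A) :
    {additive tensor (phom X Y) (phom K (j X)) -> phom K (j Y)} :=
  tensor_lift (@ext_comp_Dl X Y) (@ext_comp_Dr X Y).

Definition ext_mapl : {additive dsum ext_src -> dsum ext_tgt} :=
  dsum_lift (fun p : I * I =>
    dsum_in ext_tgt p.1 \o tensor_map (ext_act #(p.1) #(p.2)) idfun).

Definition ext_mapr : {additive dsum ext_src -> dsum ext_tgt} :=
  dsum_lift (fun p : I * I =>
    dsum_in ext_tgt p.2 \o
    (tensor_map idfun (ext_comp #(p.1) #(p.2)) \o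
     tensor_assoc (F #(p.2)) (phom #(p.1) #(p.2)) (phom K (j #(p.1))))).

Definition ext_val : zmodType := coeq ext_mapl ext_mapr.

(* The class of [t (x) g]. *)
Definition ext_cls (k : I) (t : F #k) (g : hom K (j #k)) : ext_val :=
  coeq_pi ext_mapl ext_mapr
    (dsum_in ext_tgt k (tens t g)).

Lemma ext_clsDl k g : {morph (fun t => ext_cls (k := k) t g) : t t' / t + t'}.
Proof. by move=> t t'; rewrite /ext_cls tensDl !raddfD. Qed.

Lemma ext_clsDr k t : {morph ext_cls (k := k) t : g g' / g + g'}.
Proof. by move=> g g'; rewrite /ext_cls tensDr !raddfD. Qed.

Lemma ext_maplE (k l : I) (t : F #l) (b : phom #k #l) (g : phom K (j #k)) :
  ext_mapl (dsum_in ext_src (k, l) (tens (tens t b) g)) =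
  dsum_in ext_tgt k (tens (psh_mor F b t) g).
Proof.
apply: etrans (dsum_liftE _ _) _.
apply: (congr1 (dsum_in ext_tgt k)).
apply: etrans (tensor_mapE _ _ _ _) _.
by apply: (congr1 (fun x => tens x g)); apply: tensor_liftE.
Qed.

Lemma ext_maprE (k l : I) (t : F #l) (b : hom #k #l) (g : hom K (j #k)) :
  ext_mapr (dsum_in ext_src (k, l) (tens (tens t (b : phom #k #l)) (g : phom K (j #k)))) =
  dsum_in ext_tgt l (tens t (fmor j b \oc g : phom K (j #l))).
Proof.
apply: etrans (dsum_liftE _ _) _.
apply: (congr1 (dsum_in ext_tgt l)).
apply: etrans (congr1 (tensor_map _ _) (tensor_assocE _ _ _)) _.
apply: etrans (tensor_mapE _ _ _ _) _.
by apply: (congr1 (fun x => tens t x)); apply: tensor_liftE.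
Qed.

Lemma ext_clsM (k l : I) (t : F #l) (b : hom #k #l) (g : hom K (j #k)) :
  ext_cls (psh_mor F b t) g = ext_cls t (fmor j b \oc g).
Proof.
rewrite /ext_cls -ext_maplE -ext_maprE.
exact: coeq_piE.
Qed.

Lemma ext_ext (M : zmodType) (h h' : {additive ext_val -> M}) :
  (forall k (t : F #k) (g : hom K (j #k)), h (ext_cls t g) = h' (ext_cls t g)) ->
  h =1 h'.
Proof.
move=> hh'; apply: coeq_ext => y; pose p := coeq_pi ext_mapl ext_mapr.
apply: (dsum_ext (f := h \o p) (g := h' \o p)) => k z.
by apply: (tensor_ext (f := h \o (p \o dsum_in ext_tgt k))
                      (g := h' \o (p \o dsum_in ext_tgt k))) => t g; apply: hh'.
Qed.

Section Lift.
Variables (M : zmodType) (h : forall k : I, F #k -> hom K (j #k) -> M).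
Hypotheses
  (hDl : forall k g, {morph (fun t => h (k := k) t g) : t t' / t + t'})
  (hDr : forall k t, {morph h (k := k) t : g g' / g + g'})
  (hM : forall k l (t : F #l) (b : hom #k #l) (g : hom K (j #k)),
     h (psh_mor F b t) g = h t (fmor j b \oc g)).

Definition ext_lift_tgt : {additive dsum ext_tgt -> M} :=
  dsum_lift (fun k => tensor_lift (f := fun (t : F #k) (g : phom K (j #k)) => h t g)
    (@hDl k) (@hDr k)).

Lemma ext_lift_tgtE k (t : F #k) (g : hom K (j #k)) :
  ext_lift_tgt (dsum_in ext_tgt k (tens t (g : phom K (j #k)))) = h t g.
Proof. by apply: etrans (dsum_liftE _ _) _; apply: tensor_liftE. Qed.

Lemma ext_lift_subproof x :
  ext_lift_tgt (ext_mapl x) = ext_lift_tgt (ext_mapr x).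
Proof.
apply: (dsum_ext (f := ext_lift_tgt \o ext_mapl) (g := ext_lift_tgt \o ext_mapr)).
move=> [k l]; pose i := dsum_in ext_src (k, l).
apply: (tensor_ext3 (f := ext_lift_tgt \o (ext_mapl \o i))
                    (g := ext_lift_tgt \o (ext_mapr \o i))) => t b g.
apply: etrans (congr1 ext_lift_tgt (ext_maplE t b g)) _.
apply: etrans (esym (congr1 ext_lift_tgt (ext_maprE t b g))).
apply: etrans (ext_lift_tgtE _ _) (etrans _ (esym (ext_lift_tgtE _ _))).
exact: hM.
Qed.

Definition ext_lift : {additive ext_val -> M} := coeq_lift ext_lift_subproof.

Lemma ext_liftE k (t : F #k) (g : hom K (j #k)) : ext_lift (ext_cls t g) = h t g.
Proof. by apply: etrans (coeq_liftE _ _) _; apply: ext_lift_tgtE. Qed.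
End Lift.
End Value.

Section Mor.
Variables (K L : C) (f : hom K L).

Let h (k : I) (t : F #k) (g : hom L (j #k)) : ext_val K := ext_cls t (g \oc f).

Lemma ext_act_Dl k g : {morph (fun t => @h k t g) : t t' / t + t'}.
Proof. exact: ext_clsDl. Qed.

Lemma ext_act_Dr k t : {morph @h k t : g g' / g + g'}.
Proof. by move=> g g'; rewrite /h compDl; apply: ext_clsDr. Qed.

Lemma ext_act_M k l (t : F #l) (b : hom #k #l) (g : hom L (j #k)) :
  h (psh_mor F b t) g = h t (fmor j b \oc g).
Proof. by rewrite /h ext_clsM compA. Qed.

Definition ext_mor : {additive ext_val L -> ext_val K} :=
  ext_lift ext_act_Dl ext_act_Dr ext_act_M.

Lemma ext_morE k (t : F #k) (g : hom L (j #k)) :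
  ext_mor (ext_cls t g) = ext_cls t (g \oc f).
Proof. exact: ext_liftE. Qed.
End Mor.

Lemma ext_mor1 (K : C) x : ext_mor (idm K) x = x.
Proof.
by apply: (ext_ext (h' := idfun)) => k t g; rewrite ext_morE compm1.
Qed.

Lemma ext_morM (K L M : C) (g : hom L M) (f : hom K L) x :
  ext_mor (g \oc f) x = ext_mor f (ext_mor g x).
Proof.
apply: (ext_ext (h' := ext_mor f \o ext_mor g)) => k t u.
by rewrite -[RHS]/(ext_mor f (ext_mor g _)) !ext_morE compA.
Qed.

Lemma ext_morD (K L : C) (f g : hom K L) x :
  ext_mor (f + g) x = ext_mor f x + ext_mor g x.
Proof.
apply: (ext_ext (h' := ext_mor f \+ ext_mor g)) => k t u.
rewrite -[RHS]/(ext_mor f (ext_cls t u) + ext_mor g (ext_cls t u)) !ext_morE.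
by rewrite compDr; apply: ext_clsDr.
Qed.

Definition ext_ob : presheaf C := Presheaf ext_mor1 ext_morM ext_morD.
End Ob.

Section Map.
Variables (F G : presheaf A) (a : psh_hom F G).

Section Value.
Variable K : C.

Let h (k : I) (t : F #k) (g : hom K (j #k)) : ext_val G K := ext_cls (a _ t) g.

Lemma ext_map_Dl k g : {morph (fun t => @h k t g) : t t' / t + t'}.
Proof. by move=> t t'; rewrite /h raddfD; apply: ext_clsDl. Qed.

Lemma ext_map_Dr k t : {morph @h k t : g g' / g + g'}.
Proof. exact: ext_clsDr. Qed.

Lemma ext_map_M k l (t : F #l) (b : hom #k #l) (g : hom K (j #k)) :
  h (psh_mor F b t) g = h t (fmor j b \oc g).
Proof. by rewrite /h psh_nat ext_clsM. Qed.

Definition ext_map_val : {additive ext_val F K -> ext_val G K} :=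
  ext_lift ext_map_Dl ext_map_Dr ext_map_M.

Lemma ext_map_valE k (t : F #k) (g : hom K (j #k)) :
  ext_map_val (ext_cls t g) = ext_cls (a _ t) g.
Proof. exact: ext_liftE. Qed.
End Value.

Lemma ext_map_nat (K L : C) (f : hom K L) x :
  ext_map_val K (psh_mor (ext_ob F) f x) = psh_mor (ext_ob G) f (ext_map_val L x).
Proof.
rewrite -[LHS]/((ext_map_val K \o ext_mor F f) x).
apply: (ext_ext (h' := ext_mor G f \o ext_map_val L)) => k t g.
rewrite -[LHS]/(ext_map_val K (ext_mor F f _)).
rewrite -[RHS]/(ext_mor G f (ext_map_val L _)).
by rewrite ext_morE !ext_map_valE ext_morE.
Qed.

Definition ext_map : psh_hom (ext_ob F) (ext_ob G) :=
  @PshHom C (ext_ob F) (ext_ob G) ext_map_val ext_map_nat.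
End Map.

Lemma ext_map1 (F : psh A) : ext_map (idm F) = idm (ext_ob F : psh C).
Proof.
apply: psh_hom_ext => K; apply: (ext_ext (h' := idfun)) => k t g.
exact: ext_map_valE.
Qed.

Lemma ext_mapM (F G H : psh A) (b : hom G H) (a : hom F G) :
  ext_map (b \oc a) = (ext_map b : hom (ext_ob G : psh C) (ext_ob H)) \oc ext_map a.
Proof.
apply: psh_hom_ext => K.
apply: (ext_ext (h' := ext_map_val b K \o ext_map_val a K)) => k t g.
rewrite -[RHS]/(ext_map_val b K (ext_map_val a K (ext_cls t g))).
apply: etrans (ext_map_valE _ _ _) (esym _).
exact: etrans (congr1 (ext_map_val b K) (ext_map_valE a t g)) (ext_map_valE b _ g).
Qed.

Definition ext : functor (psh A) (psh C) :=
  @Functor (psh A) (psh C) ext_ob ext_map ext_map1 ext_mapM.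

(** ** Adjunction *)

(* Identities of [X], up to transport along [#(sm_of sA X) = X]. *)
Definition sm_to (X : A) : hom #(sm_of sA X) X := eq_hom (sm_ofK sA X).
Definition sm_from (X : A) : hom X #(sm_of sA X) := eq_hom (esym (sm_ofK sA X)).

Lemma sm_to_from (X : A) : sm_to X \oc sm_from X = idm X.
Proof. exact: eq_homV. Qed.

Section Unit.
Variable F : presheaf A.

(* The unit of the adjunction: the class of [t (x) idm]. *)
Definition ext_in (X : A) (t : F X) : ext_ob F (j X) :=
  ext_cls (psh_mor F (sm_to X) t) (fmor j (sm_from X)).

Lemma ext_inD (X : A) : {morph @ext_in X : t t' / t + t'}.
Proof. by move=> t t'; rewrite /ext_in raddfD; apply: ext_clsDl. Qed.

Lemma ext_in_act (X : A) (t : F X) (K : C) (g : hom K (j X)) :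
  psh_mor (ext_ob F) g (ext_in t) =
  ext_cls (psh_mor F (sm_to X) t) (fmor j (sm_from X) \oc g).
Proof. exact: ext_morE. Qed.

Lemma ext_in_cls k (t : F #k) (K : C) (g : hom K (j #k)) :
  psh_mor (ext_ob F) g (ext_in t) = ext_cls t g.
Proof.
by rewrite ext_in_act ext_clsM compA -fmorM sm_to_from fmor1 comp1m.
Qed.

Lemma ext_in_nat (X Y : A) (f : hom X Y) (t : F Y) :
  ext_in (psh_mor F f t) = psh_mor (ext_ob F) (fmor j f) (ext_in t).
Proof.
rewrite ext_in_act /ext_in -psh_morM.
have -> : f \oc sm_to X = sm_to Y \oc (sm_from Y \oc f \oc sm_to X).
  by rewrite !compA sm_to_from comp1m.
rewrite psh_morM ext_clsM -!fmorM -!compA sm_to_from compm1.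
by rewrite fmorM.
Qed.
End Unit.

Section Transpose.
Variables (F : presheaf A) (G : presheaf C).

Section Right.
Variable a : psh_hom (ext_ob F) G.

Lemma transpose_D (X : A) :
  {morph (fun t : F X => a (j X) (ext_in t)) : t t' / t + t'}.
Proof. by move=> t t'; rewrite ext_inD raddfD. Qed.

Lemma transpose_nat (X Y : A) (f : hom X Y) (t : F Y) :
  a (j X) (ext_in (psh_mor F f t)) =
  psh_mor (restr_ob j G) f (a (j Y) (ext_in t)).
Proof. by rewrite ext_in_nat psh_nat. Qed.

Definition transpose : psh_hom F (restr_ob j G) :=
  @PshHom A F (restr_ob j G) (fun X => mk_additive (@transpose_D X)) transpose_nat.
End Right.

Section Left.
Variable b : psh_hom F (restr_ob j G).

Section Value.
Variable K : C.

Let h (k : I) (t : F #k) (g : hom K (j #k)) : G K := psh_mor G g (b _ t).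

Lemma transposeV_Dl k g : {morph (fun t => @h k t g) : t t' / t + t'}.
Proof. by move=> t t'; rewrite /h !raddfD. Qed.

Lemma transposeV_Dr k t : {morph @h k t : g g' / g + g'}.
Proof. by move=> g g'; apply: psh_morD. Qed.

Lemma transposeV_M k l (t : F #l) (c : hom #k #l) (g : hom K (j #k)) :
  h (psh_mor F c t) g = h t (fmor j c \oc g).
Proof. by rewrite /h psh_nat psh_morM. Qed.

Definition transposeV_val : {additive ext_val F K -> G K} :=
  ext_lift transposeV_Dl transposeV_Dr transposeV_M.

Lemma transposeV_valE k (t : F #k) (g : hom K (j #k)) :
  transposeV_val (ext_cls t g) = psh_mor G g (b _ t).
Proof. exact: ext_liftE. Qed.
End Value.

Lemma transposeV_nat (K L : C) (f : hom K L) x :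
  transposeV_val K (psh_mor (ext_ob F) f x) = psh_mor G f (transposeV_val L x).
Proof.
rewrite -[LHS]/((transposeV_val K \o ext_mor F f) x).
apply: (ext_ext (h' := psh_mor G f \o transposeV_val L)) => k t g.
apply: etrans (congr1 (transposeV_val K) (ext_morE f t g)) _.
apply: etrans (transposeV_valE _ _) _.
by apply: etrans (esym (congr1 (psh_mor G f) (transposeV_valE t g))); apply: psh_morM.
Qed.

Definition transposeV : psh_hom (ext_ob F) G :=
  @PshHom C (ext_ob F) G transposeV_val transposeV_nat.

Lemma transposeVK : transpose transposeV = b.
Proof.
apply: psh_hom_ext => X t; apply: etrans (transposeV_valE _ _) _.
by rewrite psh_nat -psh_morM -fmorM sm_to_from fmor1 psh_mor1.
Qed.
End Left.

Lemma transposeK (a : psh_hom (ext_ob F) G) : transposeV (transpose a) = a.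
Proof.
apply: psh_hom_ext => K; apply: ext_ext => k t g.
apply: etrans (transposeV_valE _ _ _) _.
by rewrite -[LHS]/(psh_mor G g (a _ (ext_in t))) -psh_nat ext_in_cls.
Qed.
End Transpose.

Lemma transpose_natl (F F' : psh A) (G : psh C) (f : hom F' F) (h : hom (ext F) G) :
  transpose (h \oc fmor ext f) = (transpose h : hom F (restr j G)) \oc f.
Proof.
apply: psh_hom_ext => X t.
rewrite -[LHS]/(h _ (ext_map_val f _ (ext_in t))).
rewrite -[RHS]/(h _ (ext_in (f X t))); congr (h _ _).
by rewrite ext_map_valE /ext_in psh_nat.
Qed.

Lemma transpose_natr (F : psh A) (G G' : psh C) (g : hom G G') (h : hom (ext F) G) :
  transpose (g \oc h) = fmor (restr j) g \oc (transpose h : hom F (restr j G)).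
Proof. exact: psh_hom_ext. Qed.

Definition ext_restr_adj : adjunction ext (restr j) :=
  @Adjunction (psh A) (psh C) ext (restr j) transpose transposeV
    transposeK transposeVK transpose_natl transpose_natr.

Lemma counitE (G : presheaf C) (K : C) k (s : G (j #k)) (g : hom K (j #k)) :
  (counit ext_restr_adj G : psh_hom _ _) K (ext_cls (s : restr_ob j G #k) g) =
  psh_mor G g s.
Proof. exact: transposeV_valE. Qed.
End Extension.

(** * The Freyd functor *)

Lemma Presheaf_ext (A : preadditive) (F : A -> zmodType)
    (m m' : forall X Y : A, hom X Y -> {additive F Y -> F X}) m1 m1' mM mM' mD mD' :
  (forall X Y f x, m X Y f x = m' X Y f x) ->
  @Presheaf A F m m1 mM mD = @Presheaf A F m' m1' mM' mD'.
Proof.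
move=> mm'; have em : m = m'.
  by do 3 (apply: functional_extensionality_dep => ?); apply: additive_ext.
by case: _ / em m1' mM' mD' mm' => *; congr Presheaf; apply: Prop_irrelevance.
Qed.

Definition psh_zero (A : preadditive) (F G : presheaf A) : psh_hom F G :=
  @PshHom A F G (fun=> \0) (fun _ _ f _ => esym (raddf0 (psh_mor G f))).

Section Freyd.
Variables (T : triangulated) (B : T -> Prop).

Definition Freyd_functor : functor T (psh (full B)) := yoneda (full_incl B).

Definition Yoneda_functor : functor T (psh (full (thick B))) :=
  yoneda (full_incl (thick B)).

Definition restriction : functor (psh (full (thick B))) (psh (full B)) :=
  restr (full_sub (@sub_thick T B)).

Lemma Freyd_restriction (X : T) : Freyd_functor X = restriction (Yoneda_functor X).
Proof.
exact: Presheaf_ext.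
Qed.

Definition freyd_conjecture :=
  faithful (functor_comp Freyd_functor (full_incl (thick B))).

Lemma freyd_conjectureP : freyd_conjecture <->
  forall (X Y : full (thick B)) (f : hom X Y),
    fmor Freyd_functor f = psh_zero (Freyd_functor (sval X)) (Freyd_functor (sval Y))
    <-> f = 0.
Proof.
have F0 (X Y : T) : fmor Freyd_functor (0 : hom X Y) = psh_zero _ _.
  by apply: psh_hom_ext => K x; apply: comp0m.
split=> [H X Y f | H X Y f g fg].
  split=> [f0|->]; last exact: F0.
  by apply: H; apply: etrans f0 (esym (F0 _ _)).
apply/eqP; rewrite -subr_eq0; apply/eqP/H.
apply: psh_hom_ext => K x; have fgx := congr1 (fun h : psh_hom _ _ => h K x) fg.
apply: etrans (compDl (f : hom (sval X) (sval Y)) (- g) x) _.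
rewrite [X in X + _]fgx.
apply: etrans (esym (compDl (g : hom (sval X) (sval Y)) (- g) x)) _.
by rewrite subrr comp0m.
Qed.

(* The left adjoint of [restriction]. *)
Definition extension (smB : small (full B)) :
    functor (psh (full B)) (psh (full (thick B))) :=
  ext (full_sub (@sub_thick T B)) smB.

Definition extension_restriction_adj (smB : small (full B)) :
    adjunction (extension smB) restriction :=
  ext_restr_adj (full_sub (@sub_thick T B)) smB.
End Freyd.

(* Main.v *)
From mathcomp Require Import all_boot.
Require Import Defs.

Set Implicit Arguments.
Unset Strict Implicit.
Unset Printing Implicit Defensive.

(** The proof is formal. Under an adjunction [L -| R], the transpose of
    [a \oc counit] is [fmor R a]; so [fmor R a] determines [a \oc counit], and it
    determines [a] itself as soon as the counit at the source of [a] can be cancelled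
    on the right. Take [R] to be restriction from presheaves on the thick subcategory
    to presheaves on [B], and [a] the natural transformation induced by a map [f].
    Restricting [a] gives the value of the Freyd functor at [f], so this value
    determines [a]; and [a] determines [f] by the Yoneda lemma, since [a] sends the
    identity of the source of [f] to [f]. *)

Lemma is_iso_epi (C : category) (X Y Z : C) (e : hom X Y) (a b : hom Y Z) :
  is_iso e -> a \oc e = b \oc e -> a = b.
Proof.
by move=> [s [_ es]] ab; rewrite -[a]compm1 -[b]compm1 -es !compA ab.
Qed.

Lemma adj_comp_counit (C D : category) (L : functor C D) (R : functor D C)
    (adjLR : adjunction L R) (G H : D) (a : hom G H) :
  adj adjLR (a \oc counit adjLR G) = fmor R a.
Proof. by rewrite adj_natr /counit adjVK compm1. Qed.

(** A right adjoint is faithful on the maps out of an object where the counit is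
    invertible: by [adj_comp_counit] it acts on them as precomposition with the counit
    followed by a bijection. *)
Lemma right_adjoint_faithful_at (C D : category) (L : functor C D) (R : functor D C)
    (adjLR : adjunction L R) (G H : D) (a b : hom G H) :
  is_iso (counit adjLR G) -> fmor R a = fmor R b -> a = b.
Proof.
move=> iso_counit Rab; apply: (is_iso_epi iso_counit).
by apply: (can_inj (@adjK _ _ _ _ adjLR _ _)); rewrite !adj_comp_counit.
Qed.

Lemma full_yoneda_faithful (A : preadditive) (P : A -> Prop) (X Y : A)
    (f g : hom X Y) :
  P X -> fmor (yoneda (full_incl P)) f = fmor (yoneda (full_incl P)) g -> f = g.
Proof.
move=> PX fg; rewrite -[f]compm1 -[g]compm1.
pose j := full_incl P.
exact: (congr1 (fun a : psh_hom (yoneda_ob j X) (yoneda_ob j Y) =>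
                  a (exist P X PX) (idm X)) fg).
Qed.

Theorem proposition1 (T : triangulated) (B : T -> Prop)
    (smallB : small (full B))
    (SigmaB : forall X : T, B X -> B (Sigma T X)) :
  (forall X : T, thick B X ->
     is_iso (counit (extension_restriction_adj smallB) (Yoneda_functor B X))) ->
  freyd_conjecture B.
Proof.
move=> counit_iso X Y f g Ffg.
apply: (@full_yoneda_faithful T (thick B) (sval X) (sval Y) f g (svalP X)).
apply: (right_adjoint_faithful_at (counit_iso _ (svalP X))).
(* [Freyd_functor] and [restriction] after [Yoneda_functor] have the same underlying
   groups and maps, but as presheaves they carry different proofs of the functor laws;
   the equation is therefore transferred elementwise. *)
apply: psh_hom_ext => K x.
pose j := full_incl B.
exact: (congr1 (fun a : psh_hom (yoneda_ob j (sval X)) (yoneda_ob j (sval Y)) =>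
                  a K x) Ffg).
Qed.
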